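(* For any integer $r\ge 2$ there is a number $t^\ast=t^\ast(r)$ such that for any integer $t\ge 2$, the function $F(\rho_1,\dots,\rho_r)=\sum_{i=1}^r\rho_i(1-\rho_i)^t$ on the simplex $\{\rho\in\mathbb{R}^r:\rho_i\ge 0 \text{ for all } i,\ \sum_{i=1}^r\rho_i=1\}$ is maximized by the Turán solution when $t<t^\ast$ and by a skew solution when $t\ge t^\ast$.
   Context: Fix $r,t\geq 2$. The Turán solution is the point $(1/r,\dots,1/r)$. Let $g(\rho)=\frac{d}{d\rho}\big[\rho(1-\rho)^t\big]=(1-\rho)^{t-1}(1-(t+1)\rho)$ for $\rho\in[0,1]$ and let $\phi_{\min}=g(2/(t+1))$ be the minimum of $g$ on $[0,1]$. A skew solution (for the given $r,t$) is a point $(\alpha,\dots,\alpha,\beta,\dots,\beta)$, up to permutation of coordinates, with $a\ge1$ coordinates equal to $\alpha$ and $b\ge1$ coordinates equal to $\beta$, $a+b=r$, such that $\frac1{t+1}\le\alpha<\frac2{t+1}<\beta\le 1$, $g(\alpha)=g(\beta)=\phi$ for some $\phi\in(\phi_{\min},0]$, and $a\alpha+b\beta=1$. *)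

(* Defs.v *)
From HB Require Import structures.
From mathcomp Require Import all_boot all_order all_algebra all_fingroup.
From mathcomp Require Import all_classical all_reals all_analysis.
From mathcomp Require Import ring.
Set Implicit Arguments.
Unset Strict Implicit.
Unset Printing Implicit Defensive.
Import Order.TTheory GRing.Theory Num.Theory.
Import numFieldNormedType.Exports.
Local Open Scope classical_set_scope.
Local Open Scope ring_scope.

Definition std_simplex (R : realType) (r : nat) : set 'rV[R]_r :=
  [set rho | (forall i, 0 <= rho 0 i) /\ \sum_(i < r) rho 0 i = 1].

Definition objective (R : realType) (r t : nat) (rho : 'rV[R]_r) : R :=
  \sum_(i < r) rho 0 i * (1 - rho 0 i) ^+ t.

(* Maximizers need not be unique. *)
Definition maximized_by (R : realType) (r : nat) (f : 'rV[R]_r -> R)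
    (D : set 'rV[R]_r) (rho : 'rV[R]_r) : Prop :=
  D rho /\ forall sigma, D sigma -> f sigma <= f rho.

Definition turan_solution (R : realType) (r : nat) : 'rV[R]_r := const_mx (r%:R^-1).

Definition gfun (R : realType) (t : nat) : R -> R :=
  derive1 (fun rho : R => rho * (1 - rho) ^+ t).

Lemma gfunE (R : realType) (t : nat) (rho : R) : (0 < t)%N ->
  gfun t rho = (1 - rho) ^+ t.-1 * (1 - t.+1%:R * rho).
Proof.
case: t => // t _; rewrite /gfun derive1E.
have H1 : is_derive rho (1 : R) (fun x : R => 1 - x) (0 - 1).
  exact: is_deriveB.
have H2 := is_deriveX t.+1 H1.
have -> : (fun x : R => x * (1 - x) ^+ t.+1) =
    (id : R -> R) * ((fun x : R => 1 - x) ^+ t.+1).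
  by apply/funext => x; rewrite /GRing.mul /= exprfctE.
have H := is_deriveM (is_derive_id rho (1 : R)) H2.
rewrite (@derive_val _ _ _ _ _ _ _ H) /GRing.scale /= !exprfctE.
rewrite exprS -[t.+2%:R]natr1; ring.
Qed.

(* The minimum of gfun t on [0, 1]. *)
Definition phi_min (R : realType) (t : nat) : R := gfun t (2 / t.+1%:R).

(* Coordinate i of rho is coordinate s i of (alpha, .., alpha, beta, .., beta),
   whose first a entries are alpha. *)
Definition skew_solution (R : realType) (r t : nat) (rho : 'rV[R]_r) : Prop :=
  exists (a b : nat) (alpha beta phi : R) (s : 'S_r),
    [/\ (1 <= a)%N, (1 <= b)%N & (a + b = r)%N] /\
    rho = \row_i (if (s i < a)%N then alpha else beta) /\
    [/\ t.+1%:R^-1 <= alpha, alpha < 2 / t.+1%:R,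
        2 / t.+1%:R < beta & beta <= 1] /\
    [/\ gfun t alpha = phi, gfun t beta = phi, phi_min R t < phi & phi <= 0] /\
    a%:R * alpha + b%:R * beta = 1.

(* Main.v *)
Require Import Defs.
From mathcomp Require Import all_boot all_order all_algebra all_fingroup.
From mathcomp Require Import all_classical all_reals all_analysis.
From mathcomp Require Import ring lra.
Set Implicit Arguments.
Unset Strict Implicit.
Unset Printing Implicit Defensive.
Import Order.TTheory GRing.Theory Num.Theory.
Import numFieldNormedType.Exports.
Local Open Scope classical_set_scope.
Local Open Scope ring_scope.

(** The proof combines two observations.

    Dichotomy: for every t >= 2, a maximizer either has all coordinates equal
    to 1/r or is a skew solution.  Splitting a coordinate in two halves strictly
    increases the objective, so a maximizer has no zero coordinate
    ([maximizer_positive]); the Lagrange condition then forces g to take one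
    value phi on all its coordinates ([maximizer_equal_gfun]).  Since g strictly
    decreases on [0, 2/(t+1)] and strictly increases on [2/(t+1), 1], it takes
    the value phi at most once on each side of 2/(t+1), so there are at most two
    distinct coordinates; and g <= 0 to the right of 2/(t+1), which gives
    phi <= 0 and alpha >= 1/(t+1) when there are two
    ([nonconstant_maximizer_skew]).  As the simplex is compact, it follows that
    some skew solution is a maximizer as soon as the Turan solution is not one.

    Monotonicity in t: the objective at rho is the mean of Y^t, where Y takes the
    value 1 - rho_i with probability rho_i, and its value at the Turan solution
    is c^t with c = 1 - 1/r.  By Jensen's inequality, E[Y^t] >= c^t implies
    E[Y^(t+1)] >= (E[Y^t])^((t+1)/t) >= c^(t+1), strictly when Y is not
    almost surely equal to c ([turan_beaten_step]).  So if a skew solution is a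
    maximizer for t, then it beats the Turan solution for t+1, and by the
    dichotomy a skew solution is again a maximizer ([skew_maximizer_succ]).

    For large t the Turan solution is beaten by any point that has a coordinate
    e in (0, 1/r), since e(1-e)^t decays more slowly than c^t
    ([turan_beaten_eventually]).  Hence t* can be taken to be the least t >= 2
    for which some skew solution is a maximizer. *)

(** * The derivative of the summand *)

Lemma is_derive_summand (R : realType) (t : nat) (x : R) :
  is_derive x (1 : R) (fun y : R => y * (1 - y) ^+ t) (gfun t x).
Proof.
rewrite /gfun derive1E; apply/derivableP.
have H1 : is_derive x (1 : R) (fun y : R => 1 - y) (0 - 1).
  exact: is_deriveB.
have H2 : is_derive x (1 : R) ((fun y : R => 1 - y) ^+ t)
    ((t%:R * (1 - x) ^+ t.-1) *: (0 - 1)).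
  case: t => [|t]; last exact: is_deriveX.
  rewrite mul0r scale0r (_ : _ ^+ 0 = cst 1); first exact: is_derive_cst.
  by apply/funext => y.
have -> : (fun y : R => y * (1 - y) ^+ t) =
    (id : R -> R) * ((fun y : R => 1 - y) ^+ t).
  by apply/funext => y; rewrite /GRing.mul /= exprfctE.
have H := is_deriveM (is_derive_id x (1 : R)) H2.
exact: (@ex_derive _ _ _ _ _ _ _ H).
Qed.

Lemma is_derive_gfun (R : realType) (n : nat) (x : R) :
  is_derive x (1 : R) (@gfun R n.+2)
    (n.+2%:R * (1 - x) ^+ n * (n.+3%:R * x - 2)).
Proof.
have -> : @gfun R n.+2 =
    ((fun y : R => 1 - y) ^+ n.+1) * (fun y : R => 1 - n.+3%:R * y).
  by apply/funext => y; rewrite gfunE// /GRing.mul /= exprfctE.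
have H1 : is_derive x (1 : R) (fun y : R => 1 - y) (0 - 1).
  exact: is_deriveB.
have H3 : is_derive x (1 : R) (fun y : R => 1 - n.+3%:R * y) (0 - n.+3%:R *: 1).
  exact: is_deriveB.
have H := is_deriveM (is_deriveX n.+1 H1) H3.
apply: (is_derive_eq H).
rewrite /GRing.scale /= !exprfctE exprS -[n.+3%:R]natr1 -[n.+2%:R]natr1; ring.
Qed.

Lemma continuous_gfun (R : realType) (n : nat) (A : set R) :
  {within A, continuous (@gfun R n.+2)}.
Proof.
apply: continuous_subspaceT => x; apply: differentiable_continuous.
by apply/derivable1_diffP; have := is_derive_gfun n x; case.
Qed.

(** The derivative of g at x is t (1 - x)^(t-2) ((t+1) x - 2), where t = n + 2, so
    on [x < 1] its sign changes exactly at 2/(t+1). *)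
Lemma gfun_decreasing (R : realType) (n : nat) (x y : R) :
  x < y -> y <= 2 / n.+3%:R -> gfun n.+2 y < gfun n.+2 x.
Proof.
move=> xy y2; apply: (@ltr0_derive1_lt_cc _ (gfun n.+2) x (2 / n.+3%:R)).
- by move=> z _; have := is_derive_gfun n z; case.
- move=> z; rewrite in_itv /= => /andP[_ z2].
  have H := is_derive_gfun n z.
  rewrite derive1E (@derive_val _ _ _ _ _ _ _ H).
  rewrite nmulr_llt0.
    rewrite mulr_gt0// ?exprn_gt0// subr_gt0 (lt_le_trans z2)//.
    by rewrite ler_pdivrMr// mul1r ler_nat.
  by rewrite subr_lt0 mulrC -ltr_pdivlMr.
- exact: continuous_gfun.
- by rewrite in_itv /= (ltW xy).
- by rewrite in_itv /= lexx (le_trans (ltW xy)).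
- exact: xy.
Qed.

Lemma gfun_increasing (R : realType) (n : nat) (x y : R) :
  2 / n.+3%:R <= x -> x < y -> y <= 1 -> gfun n.+2 x < gfun n.+2 y.
Proof.
move=> x2 xy y1; apply: (@gtr0_derive1_lt_cc _ (gfun n.+2) x y) => //.
- by move=> z _; have := is_derive_gfun n z; case.
- move=> z; rewrite in_itv /= => /andP[xz zy].
  have H := is_derive_gfun n z.
  rewrite derive1E (@derive_val _ _ _ _ _ _ _ H).
  rewrite mulr_gt0//.
    by rewrite mulr_gt0// exprn_gt0// subr_gt0 (lt_le_trans zy).
  by rewrite subr_gt0 mulrC -ltr_pdivrMr// (le_lt_trans x2).
- exact: continuous_gfun.
- by rewrite in_itv /= lexx ltW.
- by rewrite in_itv /= lexx ltW.
Qed.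

(** By strict monotonicity on each side, two points with the same value of g are
    separated by 2/(t+1).  The factorization of g makes it nonpositive at the
    larger one and positive on [x < 1/(t+1)], which bounds the smaller. *)
Lemma gfun_equal_values (R : realType) (n : nat) (x y : R) :
  y <= 1 -> x < y -> gfun n.+2 x = gfun n.+2 y ->
  [/\ n.+3%:R^-1 <= x, x < 2 / n.+3%:R, 2 / n.+3%:R < y & gfun n.+2 x <= 0].
Proof.
move=> y1 xy gxy.
have x2 : x < 2 / n.+3%:R.
  rewrite ltNge; apply/negP => x2.
  by have := gfun_increasing x2 xy y1; rewrite gxy ltxx.
have y2 : 2 / n.+3%:R < y.
  rewrite ltNge; apply/negP => y2.
  by have := gfun_decreasing xy y2; rewrite gxy ltxx.
have g0 : gfun n.+2 x <= 0.
  rewrite gxy gfunE// mulr_ge0_le0 ?exprn_ge0 ?subr_ge0//.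
  rewrite subr_le0 mulrC -ler_pdivrMr// (le_trans _ (ltW y2))//.
  by rewrite ler_pM2r ?invr_gt0// ler1n.
split => //; rewrite leNgt; apply/negP => x1.
move: g0; rewrite leNgt => /negP; apply.
rewrite gfunE// mulr_gt0 ?exprn_gt0 ?subr_gt0//; first exact: lt_le_trans y1.
by rewrite mulrC -ltr_pdivlMr// mul1r.
Qed.

(** * A tangent-line inequality for powers *)

(** A strict form of weighted AM-GM that, averaged over y, compares consecutive
    power means with those of the constant c.  It holds by induction on the
    exponent: if P_n is the right-hand side, then
    P_(n+1) = c P_n + (n+2) y^(n+1) (y - c)^2. *)
Lemma strict_power_tangent (R : realType) (n : nat) (c y : R) :
  0 < c -> 0 <= y -> y != c ->
  0 < n.+1%:R * y ^+ n.+2 - n.+2%:R * c * y ^+ n.+1 + c ^+ n.+2.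
Proof.
move=> c0 y0 yc; elim: n => [|n IH].
  have : 0 < (y - c) ^+ 2 by rewrite exprn_even_gt0//= subr_eq0.
  by congr (0 < _); ring.
rewrite (_ : _ + _ = c * (n.+1%:R * y ^+ n.+2 - n.+2%:R * c * y ^+ n.+1 +
   c ^+ n.+2) + n.+2%:R * (y ^+ n.+1 * (y - c) ^+ 2)).
  have sq0 : 0 <= n.+2%:R * (y ^+ n.+1 * (y - c) ^+ 2).
    by apply: mulr_ge0 => //; apply: mulr_ge0; [exact: exprn_ge0|exact: sqr_ge0].
  by rewrite ltr_wpDr// mulr_gt0.
rewrite !exprS -[n.+3%:R]natr1 -[n.+2%:R]natr1; ring.
Qed.

(** * First-order conditions at a maximizer *)

Lemma summand_halving (R : realType) (t : nat) (x : R) :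
  (0 < t)%N -> 0 < x -> x <= 1 ->
  x * (1 - x) ^+ t < x / 2 * (1 - x / 2) ^+ t + x / 2 * (1 - x / 2) ^+ t.
Proof.
move=> t0 x0 x1; rewrite -mulrDl -splitr ltr_pM2l// ltrXn2r -?lt0n//; lra.
Qed.

Definition move_two (R : realType) (r : nat) (rho : 'rV[R]_r) (i j : 'I_r)
    (u v : R) : 'rV[R]_r :=
  \row_k (if k == i then u else if k == j then v else rho 0 k).

(** Stated additively, without subtraction, so that it serves both for the
    constraint (h = id) and for the objective. *)
Lemma sum_move_two (R : realType) (r : nat) (rho : 'rV[R]_r) (i j : 'I_r)
    (u v : R) (h : R -> R) : i != j ->
  \sum_k h (move_two rho i j u v 0 k) + (h (rho 0 i) + h (rho 0 j)) =
  \sum_k h (rho 0 k) + (h u + h v).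
Proof.
move=> ij; have ji : j != i by rewrite eq_sym.
rewrite (bigD1 i)// (bigD1 j)//= [X in _ = X + _](bigD1 i)// (bigD1 j)//=.
rewrite !mxE !eqxx (negbTE ji) /=.
rewrite (eq_bigr (fun k => h (rho 0 k))); first by ring.
by move=> k /andP[ki kj]; rewrite mxE (negbTE ki) (negbTE kj).
Qed.

(** Redistributing the mass of two coordinates stays in the simplex; this
    reduces first-order conditions to a problem in one variable. *)
Lemma maximizer_exchange (R : realType) (r t : nat) (rho : 'rV[R]_r)
    (i j : 'I_r) (u v : R) :
  maximized_by (@objective R r t) (@std_simplex R r) rho -> i != j ->
  0 <= u -> 0 <= v -> u + v = rho 0 i + rho 0 j ->
  u * (1 - u) ^+ t + v * (1 - v) ^+ t <=
  rho 0 i * (1 - rho 0 i) ^+ t + rho 0 j * (1 - rho 0 j) ^+ t.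
Proof.
move=> [[rho0 rho1] rhomax] ij u0 v0 uv.
have /rhomax : std_simplex (move_two rho i j u v).
  split=> [k|]; first by rewrite mxE; case: eqP => // _; case: eqP.
  have := sum_move_two rho u v id ij.
  by rewrite uv rho1 => /addIr.
have := sum_move_two rho u v (fun x => x * (1 - x) ^+ t) ij.
by rewrite /objective; lra.
Qed.

Lemma simplex_le1 (R : realType) (r : nat) (rho : 'rV[R]_r) (i : 'I_r) :
  std_simplex rho -> rho 0 i <= 1.
Proof.
by move=> [rho0 <-]; rewrite (bigD1 i)//= lerDl sumr_ge0.
Qed.

(** If coordinate i were zero, moving half of a positive coordinate to i would
    strictly increase the objective, by [summand_halving]. *)
Lemma maximizer_positive (R : realType) (r t : nat) (rho : 'rV[R]_r)
    (i : 'I_r) : (0 < t)%N ->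
  maximized_by (@objective R r t) (@std_simplex R r) rho -> 0 < rho 0 i.
Proof.
move=> t0 rhomax; have [[rho0 rho1] _] := rhomax.
rewrite lt_neqAle rho0 andbT eq_sym; apply/eqP => rhoi.
have [j rhoj] : exists j, 0 < rho 0 j.
  apply: contrapT => /forallNP rho_le0.
  have : \sum_k rho 0 k <= 0.
    by apply: sumr_le0 => k _; rewrite leNgt; apply/negP/rho_le0.
  by rewrite rho1 ler10.
have ji : j != i by apply: contraTneq rhoj => ->; rewrite rhoi ltxx.
have half0 : 0 <= rho 0 j / 2 by rewrite divr_ge0.
have halves : rho 0 j / 2 + rho 0 j / 2 = rho 0 j + rho 0 i.
  by rewrite -splitr rhoi addr0.
have := maximizer_exchange rhomax ji half0 half0 halves.
rewrite rhoi mul0r addr0 leNgt summand_halving//.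
by apply: simplex_le1; case: rhomax.
Qed.

(** Lagrange condition: with u + v fixed, the two summands as a function of u
    have an interior maximum at u = rho_i, where the derivative is
    g(rho_i) - g(rho_j). *)
Lemma maximizer_equal_gfun (R : realType) (r t : nat) (rho : 'rV[R]_r)
    (i j : 'I_r) : (0 < t)%N ->
  maximized_by (@objective R r t) (@std_simplex R r) rho ->
  gfun t (rho 0 i) = gfun t (rho 0 j).
Proof.
move=> t0 rhomax; have [->//|ij] := eqVneq i j.
pose f (x : R) := x * (1 - x) ^+ t.
pose h (s : R) := f s + f (rho 0 i + rho 0 j - s).
have dh (s : R) : is_derive s (1 : R) h (gfun t s - gfun t (rho 0 i + rho 0 j - s)).
  have Hs : is_derive s (1 : R) (fun s : R => rho 0 i + rho 0 j - s) (0 - 1).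
    exact: is_deriveB.
  have Hf := is_derive_summand t (rho 0 i + rho 0 j - s).
  have Hc := @is_derive1_comp R f _ s _ _ Hf Hs.
  have H := is_deriveD (is_derive_summand t s) Hc.
  by apply: (is_derive_eq H); rewrite /GRing.scale /=; ring.
have i0 := maximizer_positive i t0 rhomax.
have j0 := maximizer_positive j t0 rhomax.
have rest : rho 0 i + rho 0 j - rho 0 i = rho 0 j by rewrite addrAC subrr add0r.
have hmax : is_derive (rho 0 i) (1 : R) h 0.
  apply: (@derive1_at_max _ h 0 (rho 0 i + rho 0 j)).
  - by rewrite addr_ge0// ltW.
  - by move=> s _; case: (dh s).
  - by rewrite in_itv /= i0 ltrDl.
  - move=> s; rewrite in_itv /= => /andP[s0 s1]; rewrite /h rest.
    apply: maximizer_exchange rhomax ij _ _ _; first exact: ltW.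
      by rewrite subr_ge0 ltW.
    by rewrite addrC subrK.
have := @derive_val _ _ _ _ _ _ _ (dh (rho 0 i)).
rewrite (@derive_val _ _ _ _ _ _ _ hmax) rest => /esym/eqP.
by rewrite subr_eq0 => /eqP.
Qed.

(** * Maximizers are constant or skew *)

Lemma perm_to_initial_segment (r : nat) (A : {set 'I_r}) :
  exists s : 'S_r, forall i, (s i < #|A|)%N = (i \in A).
Proof.
(* s sends i to its rank in the list of A followed by its complement. *)
pose e := enum A ++ enum (~: A).
have es : size e = r by rewrite size_cat -!cardE cardsC card_ord.
have ei i : i \in e.
  by rewrite mem_cat !mem_enum finset.in_setC orbN.
have ltr i : (index i e < r)%N by rewrite -[X in (_ < X)%N]es index_mem.
have inj : injective (fun i => Ordinal (ltr i)).
  by move=> i j /(congr1 val) /= ij; rewrite -(nth_index i (ei i)) ij nth_index.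
exists (perm inj) => i; rewrite permE /= index_cat mem_enum cardE.
case: ifPn => iA; first by rewrite index_mem mem_enum.
by rewrite ltnNge leq_addr.
Qed.

(** Two distinct coordinates x < y with g(x) = g(y) lie on either side of
    2/(t+1), and every other coordinate equals the one on its own side because g
    is injective there. *)
Lemma nonconstant_maximizer_skew (R : realType) (r t : nat) (rho : 'rV[R]_r) :
  (2 <= t)%N ->
  maximized_by (@objective R r t) (@std_simplex R r) rho ->
  (exists i j, rho 0 i < rho 0 j) -> skew_solution t rho.
Proof.
case: t => [|[|n]]// _ rhomax [i [j ij]].
have simp : std_simplex rho by case: rhomax.
have g_eq k l := maximizer_equal_gfun k l (ltn0Sn n.+1) rhomax.
have [i1 i2 j2 g0] :=
  gfun_equal_values (simplex_le1 j simp) ij (g_eq i j).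
have phi : phi_min R n.+2 < gfun n.+2 (rho 0 i).
  exact: gfun_decreasing.
have two_values k : rho 0 k = if rho 0 k < 2 / n.+3%:R then rho 0 i else rho 0 j.
  have k1 := simplex_le1 k simp.
  have j1 := simplex_le1 j simp.
  case: ifPn => [k2|]; last rewrite -leNgt => k2.
    have [ki|ki|//] := ltgtP (rho 0 k) (rho 0 i).
      by have := gfun_decreasing ki (ltW i2); rewrite (g_eq i k) ltxx.
    by have := gfun_decreasing ki (ltW k2); rewrite (g_eq i k) ltxx.
  have [kj|kj|//] := ltgtP (rho 0 k) (rho 0 j).
    by have := gfun_increasing k2 kj j1; rewrite (g_eq j k) ltxx.
  by have := gfun_increasing (ltW j2) kj k1; rewrite (g_eq j k) ltxx.
pose A := [set k | rho 0 k < 2 / n.+3%:R]%SET.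
have [s sA] := perm_to_initial_segment A.
exists #|A|, #|~: A|%SET, (rho 0 i), (rho 0 j), (gfun n.+2 (rho 0 i)), s.
split.
  split; last by rewrite cardsC card_ord.
    by rewrite card_gt0; apply/set0Pn; exists i; rewrite inE.
  by rewrite card_gt0; apply/set0Pn; exists j; rewrite !inE -leNgt ltW.
split; first by apply/rowP => k; rewrite mxE sA inE -two_values.
split; first by split => //; apply: simplex_le1.
split; first by split.
rewrite -[RHS]simp.2 (bigID (mem A))/=; congr (_ + _).
  rewrite (eq_bigr (fun=> rho 0 i)); first by rewrite sumr_const mulr_natl.
  by move=> k; rewrite inE => k2; rewrite two_values k2.
rewrite (eq_bigl (mem (~: A)%SET)); last by move=> k; rewrite !inE.
rewrite (eq_bigr (fun=> rho 0 j)); first by rewrite sumr_const mulr_natl.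
by move=> k; rewrite !inE => k2; rewrite two_values (negbTE k2).
Qed.

(** * Existence of maximizers *)

Lemma turan_simplex (R : realType) (r : nat) : (0 < r)%N ->
  std_simplex (turan_solution R r).
Proof.
move=> r0; split=> [i|]; first by rewrite mxE.
rewrite (eq_bigr (fun=> r%:R^-1)); last by move=> i _; rewrite mxE.
by rewrite sumr_const card_ord -[LHS]mulr_natr mulVf// pnatr_eq0 -lt0n.
Qed.

Lemma exists_maximizer (R : realType) (r t : nat) : (0 < r)%N ->
  exists rho, maximized_by (@objective R r t) (@std_simplex R r) rho.
Proof.
move=> r0.
have coord (i : 'I_r) : continuous (fun rho : 'rV[R]_r => rho 0 i).
  exact: coord_continuous.
have sum_cont (h : 'rV[R]_r -> 'I_r -> R) :
    (forall i, continuous (h^~ i)) -> continuous (fun rho => \sum_i h rho i).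
  move=> hc; elim: (index_enum 'I_r) => [|i l IH] x.
    by under eq_fun do rewrite big_nil; exact: cst_continuous.
  under eq_fun do rewrite big_cons.
  by apply: continuousD; [exact: hc|exact: IH].
(* The simplex is closed in the compact cube. *)
have simplexE : @std_simplex R r =
    [set rho : 'rV[R]_r | forall i, `[0, 1]%classic (rho 0 i)] `&`
    [set rho : 'rV[R]_r | \sum_i rho 0 i = 1].
  apply/seteqP; split=> rho /=.
    move=> simp; split; last exact: simp.2.
    by move=> i; rewrite in_itv /= simp.1 simplex_le1.
  move=> [rho0 rho1]; split => // i.
  by have := rho0 i; rewrite in_itv /= => /andP[].
have [|||rho rhoD rhomax] := @EVT_max_rV R r (@objective R r t) (@std_simplex R r).
- by exists (turan_solution R r); exact: turan_simplex.
- rewrite simplexE; apply: compact_closedI.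
    exact: (@rV_compact R r (fun=> `[0, 1]%classic) (fun=> @segment_compact R 0 1)).
  apply: (@preimage_closed _ _ (fun rho : 'rV[R]_r => \sum_i rho 0 i) [set 1]).
    by move=> x _; exact: (sum_cont (fun rho i => rho 0 i) coord).
  exact/accessible_closed_set1/hausdorff_accessible/Rhausdorff.
- apply: continuous_subspaceT => x; apply: sum_cont => i y.
  apply: (@continuousM _ _ (fun rho : 'rV[R]_r => rho 0 i)
    (fun rho : 'rV[R]_r => (1 - rho 0 i) ^+ t)); first exact: coord.
  apply: (@continuous_comp _ _ _
    (fun rho : 'rV[R]_r => 1 - rho 0 i) (fun x : R => x ^+ t)).
    by apply: continuousB; [exact: cst_continuous|exact: coord].
  exact: exprn_continuous.
exists rho; split; first by move: rhoD; rewrite inE.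
by move=> sigma sD; apply: rhomax; rewrite inE.
Qed.

(** * Comparison with the Turan solution *)

Lemma objective_turan (R : realType) (r t : nat) : (0 < r)%N ->
  objective t (turan_solution R r) = (1 - r%:R^-1) ^+ t.
Proof.
move=> r0; rewrite /objective (eq_bigr (fun=> r%:R^-1 * (1 - r%:R^-1) ^+ t)).
  rewrite sumr_const card_ord -[LHS]mulr_natl mulrA divff ?mul1r//.
  by rewrite pnatr_eq0 -lt0n.
by move=> i _; rewrite mxE.
Qed.

(** Average [strict_power_tangent] over y = 1 - rho_k with weights rho_k: the sum
    is n+1 times the next objective, minus (n+2) c times the current one, plus
    c^(n+2).  Since the current one is at least c^(n+1), the next one exceeds
    c^(n+2). *)
Lemma turan_beaten_step (R : realType) (r t : nat) (rho : 'rV[R]_r) :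
  (1 < r)%N -> (0 < t)%N -> std_simplex rho ->
  (exists i, 0 < rho 0 i /\ rho 0 i != r%:R^-1) ->
  objective t (turan_solution R r) <= objective t rho ->
  objective t.+1 (turan_solution R r) < objective t.+1 rho.
Proof.
case: t => // n r1 _ simp [i [i0 ir]].
rewrite !objective_turan ?(ltnW r1)//; set c := 1 - _ => le_c.
have c0 : 0 < c by rewrite subr_gt0 invf_lt1 ?ltr1n// ltr0n ltnW.
pose P (y : R) := n.+1%:R * y ^+ n.+2 - n.+2%:R * c * y ^+ n.+1 + c ^+ n.+2.
have P_gt0 (y : R) : 0 <= y -> y != c -> 0 < P y.
  exact: strict_power_tangent.
have P_ge0 (y : R) : 0 <= y -> 0 <= P y.
  move=> y0; have [->|yc] := eqVneq y c; last exact/ltW/P_gt0.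
  rewrite le_eqVlt; apply/orP; left; apply/eqP.
  by rewrite /P !exprS -[n.+2%:R]natr1; ring.
have compl0 k : 0 <= 1 - rho 0 k by rewrite subr_ge0 simplex_le1.
have mean : 0 < \sum_k rho 0 k * P (1 - rho 0 k).
  rewrite (bigD1 i)//= ltr_pwDl//.
    rewrite mulr_gt0// P_gt0//; apply: contra ir => /eqP/addrI/oppr_inj ->.
    exact: eqxx.
  by rewrite sumr_ge0// => k _; rewrite mulr_ge0 ?P_ge0// simp.1.
have meanE : \sum_k rho 0 k * P (1 - rho 0 k) =
    n.+1%:R * objective n.+2 rho - n.+2%:R * c * objective n.+1 rho + c ^+ n.+2.
  rewrite /objective 2!mulr_sumr -[c ^+ n.+2 in RHS]mul1r -[X in X * c ^+ _]simp.2.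
  rewrite mulr_suml -sumrB -big_split /=; apply: eq_bigr => k _.
  by rewrite /P; ring.
move: mean; rewrite {}meanE => mean.
rewrite -(ltr_pM2l (ltr0Sn R n)).
have : n.+2%:R * c * c ^+ n.+1 <= n.+2%:R * c * objective n.+1 rho.
  by rewrite ler_pM2l// mulr_gt0.
by move: mean; rewrite [c ^+ n.+2]exprS -[n.+2%:R]natr1; lra.
Qed.

(** The witness has r - 1 coordinates e = 1/(2r).  A single one of them
    contributes e (1 - e)^t, which beats (1 - 1/r)^t = (1 - 2e)^t once
    ((1 - 2e)/(1 - e))^t < e. *)
Lemma turan_beaten_eventually (R : realType) (r : nat) : (1 < r)%N ->
  exists t (rho : 'rV[R]_r), [/\ (2 <= t)%N, std_simplex rho &
    objective t (turan_solution R r) < objective t rho].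
Proof.
case: r => // n n0.
pose e : R := (2 * n.+1%:R)^-1.
have e0 : 0 < e by rewrite invr_gt0 mulr_gt0.
have ne : n.+1%:R * e = 2^-1 by rewrite /e invfM mulrCA divff ?mulr1.
have invE : n.+1%:R^-1 = 2 * e :> R by rewrite /e invfM mulVKf.
have ne1 : n%:R * e <= 2^-1 by rewrite -ne ler_pM2r// ler_nat.
have e2 : 2 * e <= 2^-1 by rewrite -ne ler_pM2r// ler_nat.
pose q := (1 - 2 * e) / (1 - e).
have d0 : 0 < 1 - e by lra.
have q1 : `|q| < 1.
  rewrite ger0_norm; first by rewrite ltr_pdivrMr//; lra.
  by rewrite divr_ge0//; lra.
have [t [t2 qt]] : exists t, (2 <= t)%N /\ q ^+ t < e.
  have /cvgrPdist_lt /(_ _ e0) [N _ qN] := cvg_expr q1.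
  exists (maxn N 2); split; first exact: leq_maxr.
  have := qN _ (leq_maxl N 2); rewrite /= sub0r normrN; apply: le_lt_trans.
  exact: ler_norm.
pose rho : 'rV[R]_n.+1 := \row_i (if i == ord0 then 1 - n%:R * e else e).
have rho_simplex : std_simplex rho.
  split=> [i|].
    by rewrite mxE; case: ifP => _; lra.
  rewrite big_ord_recl mxE eqxx (eq_bigr (fun=> e)).
    by rewrite sumr_const card_ord -[e *+ n]mulr_natl subrK.
  by move=> i _; rewrite mxE.
exists t, rho; split => //.
rewrite objective_turan// invE.
have lt_e : (1 - 2 * e) ^+ t < e * (1 - e) ^+ t.
  by rewrite -ltr_pdivrMr ?exprn_gt0// -expr_div_n.
apply: (lt_le_trans lt_e).
have i1 : (1 < n.+1)%N by [].
rewrite /objective (bigD1 (Ordinal i1))//= mxE /= lerDl sumr_ge0// => k _.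
by rewrite mulr_ge0 ?rho_simplex.1// exprn_ge0// subr_ge0 simplex_le1.
Qed.

Lemma skew_maximizer_of_turan_beaten (R : realType) (r t : nat)
    (sigma : 'rV[R]_r) :
  (0 < r)%N -> (2 <= t)%N -> std_simplex sigma ->
  objective t (turan_solution R r) < objective t sigma ->
  exists rho : 'rV[R]_r,
    skew_solution t rho /\ maximized_by (@objective R r t) (@std_simplex R r) rho.
Proof.
move=> r0 t2 sigmaD beaten.
have [rho rhomax] := exists_maximizer R t r0.
exists rho; split => //; apply: nonconstant_maximizer_skew => //.
apply: contrapT => const.
have le_rho i j : rho 0 i <= rho 0 j.
  by rewrite leNgt; apply/negP => ij; apply: const; exists j, i.
suff rhoE : rho = turan_solution R r.
  by have := lt_le_trans beaten (rhomax.2 _ sigmaD); rewrite rhoE ltxx.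
apply/rowP => i; rewrite mxE -[RHS]mul1r -[X in X / _]rhomax.1.2.
rewrite (eq_bigr (fun=> rho 0 i)); last first.
  by move=> j _; apply/eqP; rewrite eq_le !le_rho.
by rewrite sumr_const card_ord -[_ *+ r]mulr_natr mulfK// pnatr_eq0 -lt0n.
Qed.

(** A skew solution has two distinct values, so it differs from the Turan
    solution and the strict inequality of [turan_beaten_step] applies. *)
Lemma skew_maximizer_succ (R : realType) (r t : nat) :
  (1 < r)%N -> (2 <= t)%N ->
  (exists rho : 'rV[R]_r,
    skew_solution t rho /\ maximized_by (@objective R r t) (@std_simplex R r) rho) ->
  exists rho : 'rV[R]_r,
    skew_solution t.+1 rho /\
    maximized_by (@objective R r t.+1) (@std_simplex R r) rho.
Proof.
move=> r1 t2 [rho [skew rhomax]]; have r0 := ltnW r1; have t0 := ltnW t2.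
apply: (skew_maximizer_of_turan_beaten r0 (leqW t2) rhomax.1).
apply: turan_beaten_step => //; first exact: rhomax.1; last first.
  exact/rhomax.2/turan_simplex.
apply: contrapT => const.
have rhoE i : rho 0 i = r%:R^-1.
  apply/eqP/negPn/negP => ir; apply: const; exists i; split => //.
  exact: maximizer_positive rhomax.
have [a [b [alpha [beta [phi [s [[a1 b1 abr] [rhosE [[_ alt blt _] _]]]]]]]]] := skew.
have ar : (0 < r)%N by [].
have br : (r.-1 < r)%N by rewrite prednK.
pose i := (s^-1)%g (Ordinal ar); pose j := (s^-1)%g (Ordinal br).
have ia : rho 0 i = alpha by rewrite rhosE mxE permKV /= a1.
have jb : rho 0 j = beta.
  by rewrite rhosE mxE permKV /= ltnNge -ltnS prednK// -abr -addn1 leq_add2l b1.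
by have := lt_trans alt blt; rewrite -ia -jb !rhoE ltxx.
Qed.

(** * The threshold *)

Theorem theorem3p15 (R : realType) (r : nat) (hr : (2 <= r)%N) :
  exists tstar : R, forall t : nat, (2 <= t)%N ->
    (t%:R < tstar -> maximized_by (@objective R r t) (@std_simplex R r) (turan_solution R r)) /\
    (tstar <= t%:R ->
       exists rho : 'rV[R]_r,
         skew_solution t rho /\ maximized_by (@objective R r t) (@std_simplex R r) rho).
Proof.
have r0 := ltnW hr.
pose S t := exists rho : 'rV[R]_r,
  skew_solution t rho /\ maximized_by (@objective R r t) (@std_simplex R r) rho.
have ex : exists t, `[< (2 <= t)%N /\ S t >].
  have [t [rho [t2 rhoD beaten]]] := turan_beaten_eventually R hr.
  exists t; apply/asboolP; split => //.
  exact: skew_maximizer_of_turan_beaten beaten.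
have [m /asboolP [m2 Sm] m_min] := ex_minnP ex.
exists m%:R => t t2; split; rewrite ?ltr_nat ?ler_nat => mt.
  split=> [|sigma sigmaD]; first exact: turan_simplex.
  rewrite leNgt; apply/negP => beaten.
  suff /m_min : `[< (2 <= t)%N /\ S t >] by rewrite leqNgt mt.
  by apply/asboolP; split => //; exact: skew_maximizer_of_turan_beaten beaten.
rewrite -(subnKC mt); elim: (t - m)%N => [|k IH]; first by rewrite addn0.
by rewrite addnS; apply: skew_maximizer_succ => //; rewrite (leq_trans m2) ?leq_addr.
Qed.
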